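(* There is an absolute constant $c>0$ such that for every $\phi\ge8$ and every $m_0$ there exists a $\phi$-smooth instance $\mathcal{I}$ of scheduling on restricted identical machines with some number $m\ge m_0$ of machines such that \[ \mathbb{E}_{I\sim\mathcal{I}}\left[\max_{\sigma\in\mathrm{Lex}(I)}\frac{C_{\max}(I,\sigma)}{C^*_{\max}(I)}\right]\ge c\,\frac{\log m}{\log\log m} . \]
   Context: Scheduling on restricted identical machines: machines $M=\{1,\dots,m\}$ all of speed $1$, jobs $J=\{1,\dots,n\}$, each with processing requirement $p_j\ge0$ and set $\mathcal{M}_j\subseteq M$ of allowed machines; job $j$ may only be assigned to a machine in $\mathcal{M}_j$, where it takes time $p_j$. A feasible schedule $\sigma$ assigns each job $j$ to a machine in $\mathcal{M}_j$; $J_i(\sigma)$ is the set of jobs on $i$, $L_i(\sigma)=\sum_{j\in J_i(\sigma)}p_j$, $C_{\max}(I,\sigma)=\max_iL_i(\sigma)$, and $C^*_{\max}(I)$ is the minimum makespan over feasible schedules. $\sigma$ is lex-jump optimal if for every machine $i$, every job $j\in J_i(\sigma)$ and every $i'\in\mathcal{M}_j\setminus\{i\}$: $L_{i'}(\sigma)+p_j\ge L_i(\sigma)$; $\mathrm{Lex}(I)$ is the set of lex-jump optimal schedules. A $\phi$-smooth instance consists of a choice of $m$, $n$, the sets $\mathcal{M}_j$, and for each job $j$ a density $f_j:[0,1]\to[0,\phi]$; the $p_j$ are drawn independently according to the $f_j$, yielding $I\sim\mathcal{I}$. (The paper states the bound as $\Omega(\log m/\log\log m)$.) *)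

(* Defs.v *)
From HB Require Import structures.
From mathcomp Require Import all_boot all_order all_algebra.
From mathcomp Require Import all_classical all_reals all_analysis.
From mathcomp Require Import measurable_realfun.

Set Implicit Arguments.
Unset Strict Implicit.
Unset Printing Implicit Defensive.

Import Order.TTheory GRing.Theory Num.Theory.
Import numFieldNormedType.Exports.

Local Open Scope classical_set_scope.
Local Open Scope ring_scope.

(* The combinatorial part of an instance.  Every job has at least one allowed
   machine, so that feasible schedules exist. *)
Record environment := Environment {
  machines : nat;
  jobs : nat;
  allowed : 'I_jobs -> {set 'I_machines};
  allowed_neq0 : forall j, allowed j != finset.set0 }.

Section scheduling.
Variables (R : realType) (E : environment) (p : 'I_(jobs E) -> R).

Definition schedule := {ffun 'I_(jobs E) -> 'I_(machines E)}.

Definition feasible (s : schedule) : bool := [forall j, s j \in allowed j].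

Definition jobs_on (s : schedule) (i : 'I_(machines E)) : {set 'I_(jobs E)} :=
  [set j | s j == i]%SET.

Definition load (s : schedule) (i : 'I_(machines E)) : R :=
  \sum_(j in jobs_on s i) p j.

Definition makespan (s : schedule) : R :=
  \big[Num.max/0]_(i < machines E) load s i.

(* An infimum over a finite nonempty set, hence a minimum: see
   [opt_makespan_attained]. *)
Definition opt_makespan : R :=
  inf [set makespan s | s in [set s : schedule | feasible s]].

Definition lex_jump_optimal (s : schedule) : bool :=
  feasible s &&
  [forall i, forall j in jobs_on s i, forall i' in (allowed j :\ i)%SET,
     load s i <= load s i' + p j].

(* The default value 0 of the maximum is harmless, all the ratios being
   nonnegative.  The ratio is 0 when the optimal makespan is 0; for nonnegative
   processing times this only happens when they are all 0. *)
Definition worst_lex_ratio : R :=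
  \big[Num.max/0]_(s : schedule | lex_jump_optimal s)
    (makespan s / opt_makespan).

Lemma feasible_ex : exists s : schedule, feasible s.
Proof.
have h j : {i | i \in allowed (e := E) j}.
  by apply: sigW; apply/set0Pn/allowed_neq0.
exists [ffun j => sval (h j)]; apply/forallP => j.
by rewrite ffunE; exact: (svalP (h j)).
Qed.

Lemma opt_makespan_attained : exists2 s : schedule, feasible s &
  opt_makespan = makespan s /\
  forall s' : schedule, feasible s' -> makespan s <= makespan s'.
Proof.
have [s0 fs0] := feasible_ex.
case: (Order.TotalTheory.arg_minP makespan fs0) => s fs smin.
exists s => //; split => //; apply/eqP; rewrite eq_le; apply/andP; split.
  apply: ge_inf; last by exists s.
  by exists (makespan s) => _ [t ft <-]; exact: smin.
apply: lb_le_inf; first by exists (makespan s); exists s.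
by move=> _ [t ft <-]; exact: smin.
Qed.

End scheduling.

(* A probability density [0, 1] -> [0, phi]; the values of [f] outside [0, 1]
   are irrelevant. *)
Record smooth_density (R : realType) (phi : R) (f : R -> R) : Prop :=
  SmoothDensity {
    smooth_density_measurable : measurable_fun (`[0, 1] : set R) f;
    smooth_density_bounded : forall x, x \in `[0, 1]%R -> 0 <= f x <= phi;
    smooth_density_integral :
      (\int[lebesgue_measure]_(x in `[0%R, 1%R]) (f x)%:E = 1)%E }.

Record smooth_instance (R : realType) (phi : R) := SmoothInstance {
  smooth_env :> environment;
  density : 'I_(jobs smooth_env) -> R -> R;
  densityP : forall j, smooth_density phi (density j) }.

Definition density_law (R : realType) (phi : R) (f : R -> R)
    (hf : smooth_density phi f) : set (measurableTypeR R) -> \bar R :=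
  fun A => (\int[lebesgue_measure]_(x in A `&` `[0%R, 1%R]) (f x)%:E)%E.

Section density_law_probability.
Variables (R : realType) (phi : R) (f : R -> R) (hf : smooth_density phi f).

Let law0 : density_law hf set0 = 0%E.
Proof. by rewrite /density_law set0I integral_set0. Qed.

Let law_ge0 A : (0 <= density_law hf A)%E.
Proof.
apply: integral_ge0 => x [_ x01]; rewrite lee_fin.
by have /andP[] := smooth_density_bounded hf x01.
Qed.

Let law_sigma_additive : semi_sigma_additive (density_law hf).
Proof.
move=> /= F mF tF mUF; rewrite /density_law; apply: cvg_toP.
  apply: ereal_nondecreasing_is_cvgn => m n mn.
  by apply: lee_sum_nneg_natr => // k _ _; exact: law_ge0.
rewrite setI_bigcupl ge0_integral_bigcup//=.
- by move=> k; apply: measurableI => //; exact: mF.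
- apply/measurable_EFinP; apply: measurable_funS (smooth_density_measurable hf).
    exact: measurable_itv.
  by move=> x [k _ []].
- move=> x [k _ [_ x01]]; rewrite lee_fin.
  by have /andP[] := smooth_density_bounded hf x01.
- apply/trivIsetP => i j _ _ ij; rewrite setIACA.
  by move/trivIsetP : tF => -> //; rewrite set0I.
Qed.

HB.instance Definition _ := isMeasure.Build _ _ _ (density_law hf)
  law0 law_ge0 law_sigma_additive.

Let law_setT : density_law hf setT = 1%E.
Proof. by rewrite /density_law setTI (smooth_density_integral hf). Qed.

HB.instance Definition _ := Measure_isProbability.Build _ _ _ (density_law hf)
  law_setT.

End density_law_probability.

Section product_law.
Context d (T : measurableType d) (R : realType).

Definition tuple_cons n (x : T * n.-tuple T) : n.+1.-tuple T :=
  [tuple of x.1 :: x.2].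

Lemma measurable_tuple_cons n : measurable_fun setT (@tuple_cons n).
Proof. exact: measurable_cons. Qed.

HB.instance Definition _ n :=
  isMeasurableFun.Build _ _ _ _ (@tuple_cons n) (@measurable_tuple_cons n).

(* The joint law of independent random variables with laws [P i]: see
   [product_lawE]. *)
Fixpoint product_law n : ('I_n -> probability T R) ->
    probability (n.-tuple T) R :=
  match n with
  | 0 => fun=> dirac [tuple]
  | n'.+1 => fun P =>
      distribution (P ord0 \x product_law (fun i => P (lift ord0 i)))%E
                   (@tuple_cons n')
  end.

Lemma product_lawE n (P : 'I_n -> probability T R) (A : 'I_n -> set T) :
  (forall i, measurable (A i)) ->
  product_law P [set t | forall i, A i (tnth t i)] =
  (\prod_(i < n) P i (A i))%E.
Proof.
elim: n P A => [|n IH] P A mA /=.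
  rewrite big_ord0 diracE mem_set//.
  by case.
rewrite big_ord_recl -IH// /distribution /pushforward/=.
have -> : @tuple_cons n @^-1` [set t | forall i, A i (tnth t i)] =
    A ord0 `*` [set t | forall i, A (lift ord0 i) (tnth t i)].
  apply/seteqP; split => [[x t]/= h|[x t]/= [h0 h] i].
    split; first exact: (h ord0).
    by move=> i; have := h (lift ord0 i); rewrite tnthS.
  by case: (unliftP ord0 i) => [j|] ->; rewrite ?tnthS.
rewrite product_measure1E//.
rewrite (_ : [set t | _] =
  \big[setI/setT]_(i < n) ((@tnth _ T ^~ i) @^-1` A (lift ord0 i))).
  apply: bigsetI_measurable => i _; rewrite -[X in measurable X]setTI.
  exact: measurable_tnth.
apply/seteqP; split => [t h|t].
  by apply: (big_ind (fun X : set _ => X t)) => // X Y.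
by move=> + i; rewrite (bigD1 i)//= => -[].
Qed.

End product_law.

Definition smooth_law (R : realType) (phi : R) (I : smooth_instance phi) :
    probability ((jobs I).-tuple (measurableTypeR R)) R :=
  product_law (fun j => density_law (densityP j)).

(* Main.v *)
Require Import Defs.
From mathcomp Require Import all_boot all_order all_algebra.
From mathcomp Require Import all_classical all_reals all_analysis.
From mathcomp Require Import measurable_realfun lra zify.

Set Implicit Arguments.
Unset Strict Implicit.
Unset Printing Implicit Defensive.

Import Order.TTheory GRing.Theory Num.Theory.
Local Open Scope ring_scope.

(** The machines form a forest.  Every non-root machine [v] owns a pair of jobs,
    one slightly smaller and one slightly larger than 3/4, that may run on [v]
    or on its parent; in the schedule considered, exactly one job of each pair
    runs on the parent, and which one is chosen greedily, from the roots down,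
    so as to cancel deviations.  Hence, for every realization of the sizes in
    the supports of their densities (intervals of length 1/8), the load of a
    machine of height [h] stays within 3/16 of [13/16 + h/4].  The loads of a
    machine and of its parent then differ by at most 5/8, the least size of a
    movable job, so that the schedule is lex-jump optimal, while running the
    jobs of each [v] on [v] gives makespan at most 9/4.  A machine of height
    [H] thus forces the ratio [H / 9], and [(H+1)^(H+1)] machines suffice to
    realize this height. *)

(** * Balancing loads on an abstract forest *)

(** Always move against the sign of the running value [x]: a step of size at most [d] towards zero
    overshoots by at most [d <= e]. *)
Lemma greedy_balance (R : realFieldType) (T : eqType) (f : T -> bool -> R)
    (r : seq T) (d x : R) :
  uniq r ->
  {in r, forall v, - d <= f v false <= 0} ->
  {in r, forall v, 0 <= f v true <= d} ->
  forall e, d <= e -> - e <= x <= e ->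
  exists s : T -> bool, - e <= x + \sum_(v <- r) f v (s v) <= e.
Proof.
elim: r x => [|v r IH] x /=.
  by move=> _ _ _ e _ xe; exists xpredT; rewrite big_nil addr0.
move=> /andP[vr ur] flo fhi e de xe.
have /andP[lo1 lo2] := flo v (mem_head _ _).
have /andP[hi1 hi2] := fhi v (mem_head _ _).
have [|||s sP] := IH (x + f v (x < 0)) ur _ _ e de.
- by move=> u ur'; apply: flo; rewrite inE ur' orbT.
- by move=> u ur'; apply: fhi; rewrite inE ur' orbT.
- by case: (ltP x 0) => x0; lra.
exists (fun u => if u == v then x < 0 else s u).
rewrite big_cons eqxx addrA (eq_big_seq (fun u => f u (s u)))// => u ur'.
by case: eqP => // uv; rewrite uv (negbTE vr) in ur'.
Qed.

Section forest.
Variables (R : realFieldType) (T : finType) (par : T -> T) (ht : T -> nat).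

Definition children (w : T) : {set T} := [set v | (par v == w) && (v != w)]%SET.

Hypothesis ht_par : forall v, par v != v -> ht (par v) = (ht v).+1.
Hypothesis card_children : forall w, #|children w| = (ht w %/ 3)%N.

(* [inl (v, false)] and [inl (v, true)] are the pair owned by [v]; [inr v] can
   only run on [v]. *)
Definition job : finType := ((T * bool) + T)%type.

(* Sizes lie in an interval of length 1/8 starting here.  Both jobs of the pair
   of a root stay on it, so the second one is tiny there.  The jobs [inr v]
   supply the loads 0, 1/4, 1/2 that interpolate between numbers of children. *)
Definition lower_size (j : job) : R :=
  match j with
  | inl (_, false) => 5 / 8
  | inl (v, true) => if par v == v then 0 else 3 / 4
  | inr v => (ht v %% 3)%:R / 4
  end.

(* Up to 3/16: 3/4 for each of the [h %/ 3] children and for the pair of the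
   machine itself, and [(h %% 3) / 4 + 1/16] for its private job. *)
Definition typical_load (h : nat) : R := 13 / 16 + h%:R / 4.

Variable p : job -> R.
Hypothesis p_range : forall j, lower_size j <= p j <= lower_size j + 1 / 8.

(* [s v] tells which job of the pair of [v] goes to the parent of [v]. *)
Definition destination (s : T -> bool) (j : job) : T :=
  match j with
  | inl (v, b) => if b == s v then par v else v
  | inr v => v
  end.

Definition own_load (s : T -> bool) (w : T) : R :=
  p (inr w) + if par w == w then p (inl (w, false)) + p (inl (w, true))
              else p (inl (w, ~~ s w)).

Definition forest_load (s : T -> bool) (w : T) : R :=
  own_load s w + \sum_(v in children w) p (inl (v, s v)).

Lemma forest_loadE s w : \sum_(j | destination s j == w) p j = forest_load s w.
Proof.
rewrite /job big_sumType/= big_pred1_eq addrC /forest_load /own_load -addrA.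
congr (_ + _).
transitivity (\sum_v \sum_b
    if destination s (inl (v, b)) == w then p (inl (v, b)) else 0).
  by rewrite pair_bigA big_mkcond; apply: eq_bigr; case.
rewrite (bigD1 w)//=; congr (_ + _).
  rewrite big_bool/= addrC; case: (par w =P w) => [->|/eqP/negbTE pw].
    by case: (s w); rewrite /= eqxx.
  by case: (s w); rewrite /= eqxx pw ?addr0 ?add0r.
rewrite [RHS](eq_bigl (fun v => (v != w) && (par v == w))); last first.
  by move=> v; rewrite inE andbC.
rewrite [RHS]big_mkcondr/=; apply: eq_bigr => v /negbTE vw.
by rewrite big_bool/=; case: (s v); rewrite /= vw ?addr0 ?add0r.
Qed.

(** For roots and non-roots alike, the pair contributes 3/4 up to 1/8; the private job contributes
    [(ht w %% 3) / 4 + 1/16] up to 1/16. *)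
Lemma own_load_range s w :
  - (3 / 16) <= own_load s w - (13 / 16 + (ht w %% 3)%:R / 4) <= 3 / 16.
Proof.
have /= := p_range (inr w); rewrite /own_load.
have /= := p_range (inl (w, false)); have /= := p_range (inl (w, true)).
by case: ifP => _; [lra|case: (s w); rewrite /=; lra].
Qed.

Definition balanced s w :=
  - (3 / 16) <= forest_load s w - typical_load (ht w) <= 3 / 16.

Lemma rebalance s w : exists g : T -> bool,
  - (3 / 16) <= own_load s w + \sum_(v in children w) p (inl (v, g v))
     - typical_load (ht w) <= 3 / 16.
Proof.
have pr v : v \in children w -> par v != v.
  by rewrite inE => /andP[/eqP -> +]; rewrite eq_sym.
(* Each child's job deviates from 3/4 by at most 1/8. The tolerance is 3/16 because the running sum
   starts at the deviation of the own load. *)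
have [||||g gP] := @greedy_balance R T (fun v b => p (inl (v, b)) - 3 / 4)
  (enum (children w)) (1 / 8)
  (own_load s w - (13 / 16 + (ht w %% 3)%:R / 4)) (enum_uniq _) _ _ (3 / 16).
- by move=> v _; have /= := p_range (inl (v, false)); lra.
- move=> v; rewrite mem_enum => /pr/negbTE vp.
  by have /= := p_range (inl (v, true)); rewrite vp; lra.
- lra.
- exact: own_load_range.
exists g; move: gP.
rewrite big_enum/= sumrB sumr_const card_children -mulr_natr.
have : (ht w)%:R = (ht w %/ 3)%:R * 3 + (ht w %% 3)%:R :> R.
  by rewrite -natrM -natrD -divn_eq.
by rewrite /typical_load; lra.
Qed.

(** Induction from the greatest height down: step [n] rechooses the pairs of the children of
    machines of height [M - n]. This changes neither the own loads at heights at least [M - n] nor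
    the jobs received by higher machines. *)
Lemma exists_balanced : exists s, forall w, balanced s w.
Proof.
pose M := (\max_v ht v)%N.
suff /(_ M.+1)[s sP] : forall n,
    exists s, forall w, (M < ht w + n)%N -> balanced s w.
  by exists s => w; apply: sP; lia.
elim=> [|n [s sP]].
  by exists xpredT => w; rewrite addn0 ltnNge /M leq_bigmax.
have [g gP] := fin_all_exists (rebalance s).
exists (fun v => if (ht (par v) + n == M)%N then g (par v) v else s v) => w wn.
rewrite /balanced /forest_load.
have -> : own_load
    (fun v => if (ht (par v) + n == M)%N then g (par v) v else s v) w
    = own_load s w.
  rewrite /own_load; case: (par w =P w) => // /eqP/ht_par ->.
  by case: eqP => //; lia.
have [wM|wM] := eqVneq (ht w + n)%N M.
  rewrite (eq_bigr (fun v => p (inl (v, g w v))))// => v.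
  by rewrite inE => /andP[/eqP -> _]; rewrite wM eqxx.
rewrite (eq_bigr (fun v => p (inl (v, s v)))); first by apply: sP; lia.
by move=> v; rewrite inE => /andP[/eqP -> _]; rewrite (negbTE wM).
Qed.
End forest.

(** * A concrete forest containing a node of height [H] *)

Section levels.
Local Open Scope nat_scope.
Variable H : nat.

(* The node [(h, x)] is a genuine node of level [h] when [x < level_width h];
   the others are isolated and only round up the number of nodes. *)
Definition node : finType := ('I_H.+1 * 'I_(H.+1 ^ H))%type.

Lemma node_eq (u v : node) : u.1 = v.1 :> nat -> u.2 = v.2 :> nat -> u = v.
Proof. by case: u v => [a b] [c d] /= /val_inj -> /val_inj ->. Qed.

Definition level_width (h : nat) := H.+1 ^ (H - h).

(** Node [x] of level [h+1] reserves the block of [H+1] indices of level [h] starting at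
    [x * (H+1)]. The first [(h+1) %/ 3] of them are its children, the rest are roots. *)
Definition has_parent (v : node) :=
  [&& v.1 < H, v.2 < level_width v.1 & v.2 %% H.+1 < v.1.+1 %/ 3].

Definition parent (v : node) : node :=
  if has_parent v then
    (inord v.1.+1, Ordinal (leq_ltn_trans (leq_div v.2 H.+1) (ltn_ord v.2)))
  else v.

(** Isolated nodes get height 0 so that [height w %/ 3] counts their children too. *)
Definition height (v : node) : nat :=
  if v.2 < level_width v.1 then (v.1 : nat) else 0.

Lemma level_widthS h : h < H -> level_width h = level_width h.+1 * H.+1.
Proof. by move=> hH; rewrite /level_width -expnSr subnSK. Qed.

Lemma parent1 v : has_parent v -> (parent v).1 = v.1.+1 :> nat.
Proof.
by rewrite /parent => hv; rewrite hv inordK//; case/and3P: hv; rewrite ltnS.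
Qed.

Lemma parent_neq v : (parent v != v) = has_parent v.
Proof.
apply/idP/idP; first by rewrite /parent; case: ifP; rewrite ?eqxx.
move=> hv; apply/eqP => /(congr1 (fun u : node => u.1 : nat)).
by rewrite parent1//; lia.
Qed.

Lemma height_parent v : parent v != v -> height (parent v) = (height v).+1.
Proof.
rewrite parent_neq => hv; rewrite /height parent1//.
have /and3P[vH vw _] := hv; rewrite vw /parent hv/= ltn_divLR//.
by rewrite -level_widthS// vw.
Qed.

Lemma card_children_height w : #|children parent w| = height w %/ 3.
Proof.
have chE v : (v \in children parent w) =
    [&& has_parent v, v.1.+1 == w.1 & v.2 %/ H.+1 == w.2].
  rewrite inE; apply/idP/idP => [/andP[/eqP <-]|].
    rewrite eq_sym parent_neq => hv; rewrite hv parent1// eqxx.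
    by rewrite /parent hv eqxx.
  move=> /and3P[hv v1 v2].
  have pvw : parent v = w.
    apply: node_eq; first by rewrite parent1// (eqP v1).
    by rewrite /parent hv/= (eqP v2).
  by rewrite pvw eqxx -pvw eq_sym parent_neq.
have none : height w = 0 -> #|children parent w| = 0.
  move=> w0; apply: eq_card0 => v; rewrite chE; apply/negP.
  move=> /and3P[/and3P[vH vw _] /eqP v1 /eqP v2]; move: w0.
  rewrite /height -v1 -v2 ltn_divLR// -level_widthS// vw//.
have [ww|ww] := ltnP w.2 (level_width w.1); last first.
  by rewrite none /height ltnNge ww.
have [w1|] := posnP w.1; first by rewrite none /height ww w1.
rewrite /height ww; case E : (w.1 : nat) => [//|h] _.
have hH : h < H by have := ltn_ord w.1; rewrite E ltnS.
pose c := h.+1 %/ 3.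
have bound (r : nat) : r < c -> w.2 * H.+1 + r < level_width h.
  move=> rc; rewrite level_widthS//.
  have : w.2.+1 * H.+1 <= level_width h.+1 * H.+1.
    by rewrite leq_mul2r -E ww orbT.
  apply: leq_trans; rewrite mulSn; rewrite /c in rc; lia.
have width_le : level_width h <= H.+1 ^ H by rewrite leq_pexp2l// leq_subr.
(* The children of [w], listed by their remainder modulo [H+1]; by [bound] the default [w.2] is
   never taken. *)
pose f (r : 'I_c) : node := (inord h, insubd w.2 (w.2 * H.+1 + r)).
have f1 r : (f r).1 = h :> nat by rewrite inordK// ltnW.
have f2 r : (f r).2 = w.2 * H.+1 + r :> nat.
  by rewrite val_insubd (leq_trans (bound _ (ltn_ord r)) width_le).
have rH (r : 'I_c) : r < H.+1 by have := ltn_ord r; rewrite /c; lia.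
rewrite -[RHS]card_ord -/c -(@card_imset _ _ f); last first.
  move=> r s /(congr1 (fun v : node => v.2 : nat)); rewrite !f2 => /addnI rs.
  exact: val_inj.
apply: eq_card => v; rewrite chE; apply/idP/imsetP => [|[r _ ->]].
  move=> /and3P[/and3P[vH vw vc] /eqP v1 /eqP v2].
  have v1h : v.1 = h :> nat by lia.
  rewrite v1h -/c in vc; exists (Ordinal vc) => //.
  by apply: node_eq; rewrite ?f1 ?f2//= -v2 -divn_eq.
rewrite /has_parent f1 f2 hH bound//= E eqxx/=.
by rewrite modnMDl modn_small// ltn_ord divnMDl// divn_small// addn0 eqxx.
Qed.

Lemma card_node : #|{: node}| = H.+1 ^ H.+1.
Proof. by rewrite card_prod !card_ord expnS. Qed.

Lemma height_top : height (ord_max, Ordinal (expn_gt0 H.+1 H)) = H.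
Proof. by rewrite /height/= /level_width subnn. Qed.

End levels.

(** * The ratio for fixed sizes *)

Section forest_environment.
Variables (T : finType) (par : T -> T) (ht : T -> nat).

Definition forest_allowed (j : 'I_#|{: job T}|) : {set 'I_#|T|} :=
  match enum_val j with
  | inl (v, _) => [set enum_rank v; enum_rank (par v)]
  | inr v => [set enum_rank v]
  end%SET.

Lemma forest_allowed_neq0 j : forest_allowed j != finset.set0.
Proof.
apply/set0Pn; rewrite /forest_allowed; case: (enum_val j) => [[v b]|v];
by exists (enum_rank v); rewrite !inE eqxx.
Qed.

Definition forest_env : environment := Environment forest_allowed_neq0.

Definition schedule_of (dest : job T -> T) : schedule forest_env :=
  [ffun j => enum_rank (dest (enum_val j))].

Variables (R : realType) (p : 'I_(jobs forest_env) -> R).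
Let size (j : job T) : R := p (enum_rank j).

Lemma load_schedule_of dest i :
  load p (schedule_of dest) i = \sum_(j | dest j == enum_val i) size j.
Proof.
rewrite /load (reindex (@enum_rank (job T)))/=; last first.
  by apply: onW_bij; exact: enum_rank_bij.
apply: eq_bigl => j; rewrite inE ffunE enum_rankK.
by rewrite -(inj_eq enum_val_inj) enum_rankK.
Qed.

Hypothesis ht_par : forall v, par v != v -> ht (par v) = (ht v).+1.
Hypothesis card_children : forall w, #|children par w| = (ht w %/ 3)%N.
Hypothesis p_range : forall j,
  lower_size R par ht j <= size j <= lower_size R par ht j + 1 / 8.

Lemma lower_size_ge0 (j : job T) : 0 <= lower_size R par ht j.
Proof.
by case: j => [[v []]|v] /=; [case: ifP => _; lra|lra|exact: divr_ge0].
Qed.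

Let p_ge0 j : 0 <= p j.
Proof.
rewrite -(enum_valK j); apply: le_trans (lower_size_ge0 (enum_val j)) _.
by have /andP[] := p_range (enum_val j).
Qed.

Lemma balanced_lex_jump_optimal s :
  (forall w, balanced par ht size s w) ->
  lex_jump_optimal p (schedule_of (destination par s)).
Proof.
move=> sP; apply/andP; split.
  apply/forallP => j; rewrite ffunE /= /forest_allowed.
  case: (enum_val j) => [[v b]|v] /=; rewrite ?inE ?eqxx//.
  by case: ifP => _; rewrite eqxx ?orbT.
apply/forallP => i; apply/forallP => j; apply/implyP.
rewrite inE ffunE => /eqP <-; apply/forallP => i'; apply/implyP.
rewrite inE => /andP[]; rewrite inE /= /forest_allowed.
rewrite !load_schedule_of !forest_loadE enum_rankK.
have := p_range (enum_val j); rewrite /size enum_valK.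
case: (enum_val j) => [[v b]|v] /=; last by move=> _ /negbTE nv; rewrite inE nv.
have [pv|pv] := eqVneq (par v) v.
  by rewrite pv if_same !inE orbb => _ /negbTE ->.
move=> pj; have {}pj : 5 / 8 <= p j by case: b pj; lra.
(* The typical loads of [v] and [par v] differ by 1/4 and each load is off by at most 3/16: the gap
   is at most 1/4 + 3/8 = 5/8. *)
have := sP v; have := sP (par v).
rewrite /balanced /typical_load ht_par// -natr1.
case: ifP => _ bp bv; rewrite !inE => /[swap] /orP[] /eqP ->;
  by rewrite ?eqxx// => _; rewrite enum_rankK; lra.
Qed.

(** Excludes the degenerate ratio 0: every schedule has to place some job of size at least 5/8. *)
Lemma opt_makespan_gt0 : (0 < #|T|)%N -> 0 < opt_makespan p.
Proof.
move=> /card_gt0P[v _]; have [s _ [-> _]] := opt_makespan_attained p.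
pose j : 'I_(jobs forest_env) := enum_rank (inl (v, false) : job T).
apply: lt_le_trans (le_bigmax _ _ (s j)); rewrite /load (bigD1 j) ?inE//=.
rewrite ltr_pwDl ?sumr_ge0//.
by have /= := p_range (inl (v, false)); rewrite /size -/j; lra.
Qed.

Lemma opt_makespan_le : opt_makespan p <= 9 / 4.
Proof.
(* With [id] as parent map, every pair stays on its owner. *)
have [s _ [-> /(_ (schedule_of (destination id xpredT)))]] :=
  opt_makespan_attained p.
move=> sle; apply: le_trans (sle _) _.
  apply/forallP => j; rewrite ffunE /= /forest_allowed.
  by case: (enum_val j) => [[v b]|v] /=; rewrite ?if_same !inE eqxx.
apply: bigmax_le => [|i _]; first lra.
rewrite load_schedule_of forest_loadE /forest_load.
rewrite big_pred0 ?addr0; last by move=> v; rewrite inE; case: eqP.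
rewrite /own_load eqxx; set w := enum_val i.
have /= := p_range (inr w); have /= := p_range (inl (w, false)).
have /= := p_range (inl (w, true)).
(* The private job is at most 1/2 + 1/8 and the pair at most 3/4 + 7/8, in total 9/4. *)
have : (ht w %% 3)%:R <= 2 :> R by rewrite ler_nat -ltnS ltn_mod.
by case: ifP => _; lra.
Qed.

Lemma forest_worst_lex_ratio v : (ht v)%:R / 9 <= worst_lex_ratio p.
Proof.
have [s sP] := exists_balanced ht_par card_children p_range.
apply: le_trans (le_bigmax_cond _ _ (balanced_lex_jump_optimal sP)).
have /opt_makespan_gt0 o0 : (0 < #|T|)%N by apply/card_gt0P; exists v.
rewrite ler_pdivlMr//; apply: (@le_trans _ _ ((ht v)%:R / 4)).
  by have := opt_makespan_le; have := ler0n R (ht v); nra.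
apply: le_trans (le_bigmax _ _ (enum_rank v : 'I_(machines forest_env))).
rewrite load_schedule_of forest_loadE enum_rankK.
by have := sP v; rewrite /balanced /typical_load; lra.
Qed.

End forest_environment.

(** * Random sizes and the expected ratio *)

Local Open Scope classical_set_scope.

(* [f] need not be measurable. *)
Lemma integral_ge_cst_on d (T : measurableType d) (R : realType)
    (mu : {measure set T -> \bar R}) (f : T -> R) (A : set T) (c : R) :
  measurable A -> 0 <= c -> (forall x, 0 <= f x) ->
  (forall x, A x -> c <= f x) ->
  (c%:E * mu A <= \int[mu]_x (f x)%:E)%E.
Proof.
move=> mA c0 f0 cf; rewrite ge0_integralTE; last by move=> x; rewrite lee_fin.
(* The integral is a supremum over simple functions below [f]; [c] times the indicator of [A] is one
   of them. *)
apply: ereal_sup_ubound; exists (scale_nnsfun (indic_nnsfun R mA) c0).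
  move=> x /=; rewrite lee_fin mindicE; case: (boolP (x \in A)) => xA.
    by rewrite mulr1 cf// -in_setE.
  by rewrite mulr0.
by rewrite -(sintegral_indic mu A) -(sintegralrM mu c (indic_nnsfun R mA)).
Qed.

Lemma measurable_tuple_box d (T : measurableType d) n (A : 'I_n -> set T) :
  (forall i, measurable (A i)) ->
  measurable [set t : n.-tuple T | forall i, A i (tnth t i)].
Proof.
move=> mA; rewrite (_ : [set t | _] =
    \bigcap_i ((fun t : n.-tuple T => tnth t i) @^-1` A i)).
  apply: fin_bigcap_measurable => // i _; rewrite -[X in measurable X]setTI.
  exact: measurable_tnth.
by apply/seteqP; split => [t h i _|t h i]; apply: h.
Qed.

Section uniform_density.
Variables (R : realType) (phi l : R).
Hypotheses (phi8 : 8 <= phi) (l0 : 0 <= l) (l1 : l <= 7 / 8).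

Definition eighth : set R := `[l, l + 1 / 8].

Definition uniform_density (x : R) : R := 8 * \1_eighth x.

Let eighth01 : eighth `<=` `[0, 1].
Proof.
move=> x; rewrite /eighth /= !in_itv/= => /andP[lx xl].
by move: l0 l1 => ? ?; lra.
Qed.

(** Stated for general [A] to serve both for the total mass on [0, 1] and for the probability of the
    support. *)
Let mass (A : set R) : measurable A -> eighth `<=` A ->
  (\int[lebesgue_measure]_(x in A) (uniform_density x)%:E = 1)%E.
Proof.
move=> mA lA; rewrite /uniform_density.
under eq_integral do rewrite EFinM.
rewrite ge0_integralZl//; last first.
  by apply/measurable_EFinP/measurable_indic; exact: measurable_itv.
rewrite integral_indic//; last exact: measurable_itv.
rewrite setIidl// /eighth /= lebesgue_measure_itv/= lte_fin ltrDl ifT;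
  last by lra.
by rewrite -EFinD -EFinM; congr EFin; lra.
Qed.

Lemma uniform_smooth_density : smooth_density phi uniform_density.
Proof.
split.
- apply: measurable_funM => //; apply: measurable_indic; exact: measurable_itv.
- move=> x _; rewrite /uniform_density indicE.
  by move: phi8 => ?; case: (x \in _); rewrite ?mulr1 ?mulr0; lra.
- by apply: mass => //; exact: measurable_itv.
Qed.

Lemma density_law_eighth (h : smooth_density phi uniform_density) :
  density_law h eighth = 1%E.
Proof.
rewrite /density_law; apply: mass.
  by apply: measurableI; exact: measurable_itv.
by move=> x ex; split => //; exact: eighth01.
Qed.

End uniform_density.

Local Close Scope classical_set_scope.

Lemma worst_lex_ratio_ge0 (R : realType) (E : environment)
  (p : 'I_(jobs E) -> R) : 0 <= worst_lex_ratio p.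
Proof. exact: bigmax_ge_id. Qed.

Section forest_instance.
Variables (R : realType) (phi : R).
Hypothesis phi8 : 8 <= phi.
Variables (T : finType) (par : T -> T) (ht : T -> nat).
Hypothesis ht_par : forall v, par v != v -> ht (par v) = (ht v).+1.
Hypothesis card_children : forall w, #|children par w| = (ht w %/ 3)%N.

Lemma lower_size_le (j : job T) : lower_size R par ht j <= 7 / 8.
Proof.
case: j => [[v []]|v] /=; [case: ifP => _; lra|lra|].
have : (ht v %% 3)%:R <= 2 :> R by rewrite ler_nat -ltnS ltn_mod.
by lra.
Qed.

Definition forest_density (j : 'I_(jobs (forest_env par))) : R -> R :=
  uniform_density (lower_size R par ht (enum_val j)).

Lemma forest_densityP j : smooth_density phi (forest_density j).
Proof.
by apply: uniform_smooth_density => //;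
  [exact: lower_size_ge0|exact: lower_size_le].
Qed.

Definition forest_instance : smooth_instance phi :=
  SmoothInstance forest_densityP.

(** The bound for fixed sizes holds on the product of the supports, a box of probability 1. *)
Lemma forest_expectation v : (((ht v)%:R / 9)%:E <=
  'E_(smooth_law forest_instance)[fun p => worst_lex_ratio (tnth p)])%E.
Proof.
rewrite unlock.
pose box (j : 'I_(jobs forest_instance)) : set (measurableTypeR R) :=
  eighth (lower_size R par ht (enum_val j)).
have mbox (j : 'I_(jobs forest_instance)) : measurable (box j).
  exact: measurable_itv.
have : smooth_law forest_instance
    [set t | forall j, box j (tnth t j)]%classic = 1%E.
  rewrite /smooth_law product_lawE// big1// => j _.
  by apply: density_law_eighth; [exact: lower_size_ge0|exact: lower_size_le].
move=> box1; rewrite -[leLHS]mule1 -box1; apply: integral_ge_cst_on.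
- exact: measurable_tuple_box.
- exact: divr_ge0.
- by move=> p; exact: worst_lex_ratio_ge0.
move=> p pbox; apply: forest_worst_lex_ratio => // j.
by have := pbox (enum_rank j); rewrite /box /eighth enum_rankK /= in_itv.
Qed.

End forest_instance.

(** * Asymptotics in the number of machines *)

(** The numerator is [k * ln k]; the denominator is [ln k + ln (ln k)], at least [ln k] since [k] is
    at least e. *)
Lemma ln_div_lnln_le (R : realType) (k : nat) : expR 1 <= k%:R :> R ->
  ln (k ^ k)%:R / ln (ln (k ^ k)%:R) <= k%:R :> R.
Proof.
move=> ek; have k0 : 0 < k%:R :> R by exact: lt_le_trans ek; exact: expR_gt0.
have lnk1 : 1 <= ln k%:R :> R by rewrite -[leLHS]expRK ler_ln ?posrE ?expR_gt0.
have k1 : 1 <= k%:R :> R by rewrite ler1n -(ltr0n R).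
have lnk0 : 0 < ln k%:R :> R by lra.
rewrite natrX lnXn// -(mulr_natr (ln _)) lnM ?posrE//.
have llk : 0 <= ln (ln k%:R) :> R by rewrite ln_ge0.
rewrite ler_pdivrMr; last by lra.
by rewrite mulrC ler_pM2l//; lra.
Qed.

Theorem theorem22 (R : realType) :
  exists c : R, 0 < c /\
    forall (phi : R) (m0 : nat), 8 <= phi ->
      exists I : smooth_instance phi,
        (m0 <= machines I)%N /\
        ((c * (ln (machines I)%:R / ln (ln (machines I)%:R)))%:E
           <= 'E_(smooth_law I)[fun p => worst_lex_ratio (tnth p)])%E.
Proof.
(* The forest gives [H / 9], and [H + 1 <= 2 * H] costs a further factor 2. *)
exists (1 / 18); split; first by lra.
move=> phi m0 phi8.
(* The three terms ensure [H + 1 <= 2 * H], enough machines, and [H + 1] at least e. *)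
pose H := maxn 1 (maxn m0 (Num.truncn (expR 1 : R))).
exists (forest_instance phi8 (@parent H) (@height H)).
have mE :
    machines (forest_instance phi8 (@parent H) (@height H)) = (H.+1 ^ H.+1)%N.
  exact: card_node.
rewrite mE; split.
  have : (H < H.+1 ^ H.+1)%N by rewrite ltnW// ltn_expl// ltnS leq_maxl.
  by move=> /ltnW; apply: leq_trans; rewrite /H !leq_max leqnn orbT.
apply: le_trans (forest_expectation phi8 (@height_parent H)
  (@card_children_height H) (ord_max, Ordinal (expn_gt0 H.+1 H))).
rewrite lee_fin height_top.
have eH : expR 1 <= H.+1%:R :> R.
  apply: le_trans (ltW (truncnS_gt _)) _; rewrite ler_nat ltnS.
  by rewrite /H !leq_max leqnn !orbT.
have := ln_div_lnln_le eH.
have : 1 <= H%:R :> R by rewrite ler1n leq_maxl.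
by rewrite -natr1; lra.
Qed.
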